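(* Let $\mathcal{G}=(\mathcal{V},\mathcal{E},\omega)$ be a finite undirected weighted graph with vertex-to-edge incidence map $\nabla$ and $K=\operatorname{diag}(\omega)\nabla$. Let $\mathcal{E}=\mathcal{E}_1\sqcup\mathcal{E}_2$ be a partition of the edge set into two nonempty disjoint subsets, with corresponding subgraphs $\mathcal{G}_1=(\mathcal{V},\mathcal{E}_1,\omega|_{\mathcal{E}_1})$ and $\mathcal{G}_2=(\mathcal{V},\mathcal{E}_2,\omega|_{\mathcal{E}_2})$ (not necessarily forests), such that 1. $\operatorname{ran}\nabla_1^\top\cap\operatorname{ran}\nabla_2^\top\supsetneq\{0\}$; 2. $\operatorname{rank}\nabla^\top>\min(\operatorname{rank}\nabla_1^\top,\operatorname{rank}\nabla_2^\top)$. Let $T=\sum_{l=1}^2 P_l^\top K_lK_l^\top P_l$. Then $\kappa(T^{-1/2}K)\geq\sqrt{2}$.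
   Context: The edges of $\mathcal{G}$ carry weights $\omega:\mathcal{E}\to(0,\infty)$. The matrix $\nabla:\mathbb{R}^{\mathcal{V}}\to\mathbb{R}^{\mathcal{E}}$ is the (transposed) incidence matrix, $(\nabla u)_e=u_i-u_j$ for each edge $e=(i,j)\in\mathcal{E}$, with an arbitrarily fixed orientation of each edge. For $l=1,2$, $P_l:\mathbb{R}^{\mathcal{E}}\to\mathbb{R}^{\mathcal{E}_l}$ is the canonical projection (restriction) $P_lp=p|_{\mathcal{E}_l}$, and $\nabla_l=P_l\nabla$, $K_l=P_lK$. $T$ is the block diagonal matrix with blocks $T_l=K_lK_l^\top$. When $T$ is singular, $T^{-1}$ is understood as the Moore–Penrose pseudoinverse, and $T^{-1/2}$ is the positive semidefinite square root of $T^{-1}$. For a nonzero real matrix $A$, the (finite) condition number is $\kappa(A)=\sigma_{\max}(A)/\sigma_{\min>0}(A)$, the ratio of the largest to the smallest nonzero singular value. *)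

(* Defs.v *)
From HB Require Import structures.
From mathcomp Require Export all_boot all_order all_algebra.
From mathcomp Require Export boolp classical_sets reals.

Set Implicit Arguments.
Unset Strict Implicit.
Unset Printing Implicit Defensive.
Import Order.TTheory GRing.Theory Num.Theory.
Local Open Scope ring_scope.

(* An edge is an unordered pair of distinct vertices; the values of [weight]
   outside [edges] are irrelevant. *)
Record wgraph (R : realType) (V : finType) := WGraph {
  edges : {set {set V}};
  edges_card2 : {in edges, forall e : {set V}, #|e| = 2%N};
  weight : {set V} -> R;
  weight_gt0 : {in edges, forall e : {set V}, 0 < weight e}
}.

Record orientation (V : finType) (E : {set {set V}}) := Orientation {
  source : {set V} -> V;
  target : {set V} -> V;
  orientationP : {in E, forall e : {set V}, e = [set source e; target e]}
}.

(* R^V is 'cV[R]_#|V| and R^E is 'cV[R]_#|E|, coordinates being numbered by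
   the standard enumerations [enum_val]. *)
Section Incidence.
Variables (R : realType) (V : finType).

Definition grad (E : {set {set V}}) (o : orientation E) : 'M[R]_(#|E|, #|V|) :=
  \matrix_(i, j) ((enum_val j == source o (enum_val i))%:R
                  - (enum_val j == target o (enum_val i))%:R).

Definition weight_mx (G : wgraph R V) : 'M[R]_#|edges G| :=
  diag_mx (\row_i weight G (enum_val i)).

(* The restriction map R^E -> R^F, for F \subset E. *)
Definition restr_mx (E F : {set {set V}}) : 'M[R]_(#|F|, #|E|) :=
  \matrix_(i, j) (enum_val i == enum_val j)%:R.

End Incidence.

Arguments grad R {V E} o.
Arguments restr_mx R {V} E F.

Section RealMatrices.
Variable R : realType.
Local Open Scope classical_set_scope.

(* The range of x |-> A x on column vectors, whereas the row-space operations
   of mxalgebra refer to x |-> x A. *)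
Definition ran m n (A : 'M[R]_(m, n)) : set 'cV[R]_m :=
  range (fun x : 'cV[R]_n => A *m x).

Definition penrose m n (A : 'M[R]_(m, n)) (X : 'M[R]_(n, m)) : Prop :=
  [/\ A *m X *m A = A, X *m A *m X = X,
      (A *m X)^T = A *m X & (X *m A)^T = X *m A].

(* The four Penrose equations have exactly one solution, so the default value
   of [xget] is never used. *)
Definition mp_inv m n (A : 'M[R]_(m, n)) : 'M[R]_(n, m) := xget 0 (penrose A).

Definition psdmx n (A : 'M[R]_n) : Prop :=
  A^T = A /\ forall x : 'cV[R]_n, 0 <= (x^T *m A *m x) 0 0.

(* For positive semidefinite A the square root exists and is unique. *)
Definition psd_sqrt n (A : 'M[R]_n) : 'M[R]_n :=
  xget 0 [set S | psdmx S /\ S *m S = A].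

Definition singular_value m n (A : 'M[R]_(m, n)) : set R :=
  [set s | 0 <= s /\ eigenvalue (A^T *m A) (s ^+ 2)].

(* [S `&` ubound S] holds at most the greatest element of S, and dually. For
   A != 0 both elements below exist. *)
Definition sigma_max m n (A : 'M[R]_(m, n)) : R :=
  let S := singular_value A in xget 0 (S `&` ubound S).

Definition sigma_min_pos m n (A : 'M[R]_(m, n)) : R :=
  let S := [set s | singular_value A s /\ s != 0] in xget 0 (S `&` lbound S).

Definition cond_number m n (A : 'M[R]_(m, n)) : R :=
  sigma_max A / sigma_min_pos A.

End RealMatrices.

(* Main.v *)
Require Import Defs.
From mathcomp Require Import spectral sesquilinear complex.
Set Implicit Arguments.
Unset Strict Implicit.
Unset Printing Implicit Defensive.

(** Write K_l = P_l K, S = T^(-1/2) and B = S K.  Since T is block diagonal with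
    blocks T_l = K_l K_l^T, its pseudoinverse is block diagonal with blocks
    T_l^+, so

      B^T B = K^T T^+ K = Q_1 + Q_2,   where Q_l = K_l^T (K_l K_l^T)^+ K_l

    is the orthogonal projector onto ran K_l^T ([row_space_proj]).  The weights
    are invertible, so ran K_l^T = ran nabla_l^T, and the squared singular
    values of B are the eigenvalues of a sum of two orthogonal projectors.

    - A nonzero v in both ranges satisfies (Q_1 + Q_2) v = 2 v, so 2 is an
      eigenvalue.
    - Say nabla_1 has the smaller rank.  As rank K_1 < rank K, some nonzero
      w = K^T c is killed by K_1, hence by Q_1.  Then
      w^T (Q_1 + Q_2) w = w^T Q_2 w <= w^T w.  Moreover w lies in
      ran Q_1 + ran Q_2 = ran (Q_1 + Q_2), so expanding w in eigenvectors of
      Q_1 + Q_2 involves positive eigenvalues only, and one of them is at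
      most 1.

    Therefore sigma_max^2 >= 2 and sigma_min^2 <= 1 ([cond_number_sum_proj]).

    Pseudoinverses, square roots and the small eigenvalue are all obtained from
    one form of the real spectral theorem ([sym_calculus]): real functions can
    be applied to a symmetric matrix, compatibly with sums and products, and
    the result depends only on the values at its eigenvalues.  An identity
    between such matrices is thereby reduced to an identity between numbers. *)

Import Order.TTheory GRing.Theory Num.Theory.
Local Open Scope ring_scope.

(** * Functions of a real symmetric matrix *)

Section SpectralCalculus.
Variable R : realType.

(** The functions are arbitrary, with no continuity, because the spectrum is
    finite.  The record is meaningful for 0 x 0 matrices too, unlike
    [horner_mx], so matrices of unknown size can use it directly. *)
Record spectral_calculus n (A : 'M[R]_n) (phi : (R -> R) -> 'M[R]_n) : Prop :=
  SpectralCalculus {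
    calc_id : phi id = A;
    calcD : forall f g, phi (fun x => f x + g x) = phi f + phi g;
    calcM : forall f g, phi (fun x => f x * g x) = phi f *m phi g;
    calc_tr : forall f, (phi f)^T = phi f;
    eq_calc : forall f g, (forall a, eigenvalue A a -> f a = g a) ->
      phi f = phi g
  }.

Lemma interpolation (F : fieldType) (s : seq F) (f : F -> F) :
  exists p : {poly F}, {in s, forall x, p.[x] = f x}.
Proof.
elim: s => [|a s [p ps]]; first by exists 0.
have [a_s|aNs] := boolP (a \in s).
  by exists p => x; rewrite inE => /predU1P[->|]; apply: ps.
pose q := \prod_(x <- s) ('X - x%:P).
have qa : q.[a] != 0 by rewrite -/(root q a) root_prod_XsubC.
exists (p + ((f a - p.[a]) / q.[a]) *: q) => x.
rewrite inE !hornerE => /predU1P[->|xs]; first by rewrite divfK// addrC subrK.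
have /rootP -> : root q x by rewrite root_prod_XsubC.
by rewrite mulr0 addr0 ps.
Qed.

(** Over R[i] the matrix is unitarily similar to a real diagonal matrix, and a
    polynomial of the latter vanishes as soon as it vanishes at each diagonal
    entry; both facts descend to R because the diagonal is real. *)
Lemma sym_spectrum n (A : 'M[R]_n.+1) : A^T = A ->
  exists2 s : seq R, (forall a, eigenvalue A a = (a \in s)) &
    forall p, {in s, forall x, root p x} -> horner_mx A p = 0.
Proof.
move=> Asym; pose toC := real_complex R; pose AC := map_mx toC A.
have AC_herm : AC \is hermsymmx.
  apply: realsym_hermsym.
    apply/is_hermitianmxP; rewrite expr0 scale1r map_mx_id//.
    by rewrite /AC map_trmx Asym.
  by apply/mxOverP => i j; rewrite mxE; apply/complex_realP; exists (A i j).
have /orthomx_spectralP ACE := hermitian_normalmx AC_herm.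
have /mxOverP d_real := hermitian_spectral_diag_real AC_herm.
set U := spectralmx AC in ACE; set d := spectral_diag AC in ACE d_real.
have Uu : U \in unitmx by apply: spectral_unit.
pose s := [seq complex.Re (d 0 i) | i <- enum 'I_n.+1].
have ds i : d 0 i = toC (complex.Re (d 0 i)) by rewrite /toC RRe_real.
have s0 p : {in s, forall x, root p x} -> horner_mx A p = 0.
  move=> sp; apply/eqP; rewrite -(map_mx_eq0 toC) map_horner_mx -/AC ACE.
  rewrite mxpoly.horner_mx_uconjC// horner_mx_diag.
  suff -> : map_mx (horner (map_poly toC p)) d = 0.
    by rewrite linear0 mulmx0 mul0mx.
  apply/rowP => i; rewrite !mxE ds horner_map (rootP (sp _ _)) ?rmorph0//.
  exact/map_f/mem_enum.
(* Eigenvalues are roots of the minimal polynomial, which divides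
   the product of the X - x over s. *)
exists s => // a; apply/idP/idP => [|/mapP[i _ ->]].
  rewrite eigenvalue_root_min -root_prod_XsubC -!dvdp_XsubCl.
  move=> /dvdp_trans; apply; apply: mxminpoly_min; apply: s0 => x xs.
  by rewrite root_prod_XsubC.
suff: eigenvalue AC (d 0 i) by rewrite ds eigenvalue_map.
apply/eigenvalueP; exists (row i U).
  rewrite -row_mul [in LHS]ACE !mulmxA mulmxV// mul1mx row_mul row_diag_mx.
  by rewrite -scalemxAl -rowE.
apply/eqP => Ui0; have : 'e_i = row i U *m invmx U :> 'rV_n.+1.
  by rewrite rowE mulmxK.
by rewrite Ui0 mul0mx => /rowP/(_ i)/eqP; rewrite !mxE !eqxx oner_eq0.
Qed.

Lemma trmx_horner n (A : 'M[R]_n.+1) p :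
  A^T = A -> (horner_mx A p)^T = horner_mx A p.
Proof.
move=> Asym; elim/poly_ind: p => [|p c IH]; first by rewrite rmorph0 linear0.
rewrite rmorphD rmorphM /= horner_mx_X horner_mx_C linearD /= tr_scalar_mx.
congr (_ + _); rewrite -[_ * _]/(_ *m _) trmx_mul Asym IH.
exact: comm_mx_horner.
Qed.

(** Evaluate at the matrix a polynomial that interpolates the function at the
    eigenvalues; polynomials of a symmetric matrix are symmetric. *)
Lemma sym_calculus n (A : 'M[R]_n) :
  A^T = A -> exists phi, spectral_calculus A phi.
Proof.
case: n A => [|n] A Asym.
  by exists (fun=> A); split=> * //; rewrite [LHS]thinmx0 [RHS]thinmx0.
have [s sE s0] := sym_spectrum Asym.
have kill p q : {in s, forall x, p.[x] = q.[x]} ->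
    horner_mx A p = horner_mx A q.
  move=> pq; apply/eqP; rewrite -subr_eq0 -rmorphB; apply/eqP/s0 => x xs.
  by rewrite /root !hornerE pq// subrr.
have [q qP] := choice (interpolation s).
exists (fun f => horner_mx A (q f)); split=> [|f g|f g|f|f g fg].
- by rewrite -[RHS]horner_mx_X; apply: kill => x xs; rewrite qP// hornerX.
- by rewrite -rmorphD; apply: kill => x xs; rewrite hornerD !qP.
- transitivity (horner_mx A (q f * q g)); last by rewrite rmorphM.
  by apply: kill => x xs; rewrite hornerM !qP.
- exact: trmx_horner.
- by apply: kill => x xs; rewrite !qP// fg// sE.
Qed.

End SpectralCalculus.

(** * Gram matrices and positive semidefinite matrices *)

Section PositiveSemidefinite.
Variable R : realType.

Definition normsq n (x : 'cV[R]_n) : R := (x^T *m x) 0 0.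

Lemma normsqE n (x : 'cV[R]_n) : normsq x = \sum_i x i 0 ^+ 2.
Proof. by rewrite /normsq mxE; apply: eq_bigr => i _; rewrite mxE. Qed.

Lemma normsq_ge0 n (x : 'cV[R]_n) : 0 <= normsq x.
Proof. by rewrite normsqE sumr_ge0// => i _; rewrite sqr_ge0. Qed.

Lemma normsq_eq0 n (x : 'cV[R]_n) : (normsq x == 0) = (x == 0).
Proof.
apply/eqP/eqP => [|->]; last by rewrite /normsq mulmx0 mxE.
rewrite normsqE => /psumr_eq0P x0; apply/colP => i; rewrite mxE.
by apply/eqP; rewrite -(sqrf_eq0 (x i 0)) x0// => j _; rewrite sqr_ge0.
Qed.

Lemma normsq_mul m n (A : 'M[R]_(m, n)) x :
  normsq (A *m x) = (x^T *m (A^T *m A) *m x) 0 0.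
Proof. by rewrite /normsq trmx_mul !mulmxA. Qed.

Lemma gram_eq0 m n (A : 'M[R]_(m, n)) : A^T *m A = 0 -> A = 0.
Proof.
move=> AA0; apply/matrixP => i j.
have /eqP : normsq (col j A) = 0.
  by rewrite colE normsq_mul AA0 mulmx0 mul0mx mxE.
by rewrite normsq_eq0 => /eqP/colP/(_ i); rewrite !mxE.
Qed.

Lemma psd_gram m n (A : 'M[R]_(m, n)) : psdmx (A^T *m A).
Proof.
split=> [|x]; first by rewrite trmx_mul trmxK.
by rewrite -normsq_mul normsq_ge0.
Qed.

Lemma psdmxD n (A B : 'M[R]_n) : psdmx A -> psdmx B -> psdmx (A + B).
Proof.
move=> [At A0] [Bt B0]; split=> [|x]; first by rewrite linearD /= At Bt.
by rewrite mulmxDr mulmxDl mxE addr_ge0.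
Qed.

Lemma psd_eigenvalue n (A : 'M[R]_n) a : psdmx A -> eigenvalue A a -> 0 <= a.
Proof.
move=> [_ Apsd] /eigenvalueP[v vA v0].
have := Apsd v^T; rewrite trmxK vA -scalemxAl mxE -[v in v *m _]trmxK.
rewrite -/(normsq _) pmulr_lge0// lt_def normsq_ge0 andbT normsq_eq0.
by rewrite trmx_eq0.
Qed.

Lemma psd_calc n (A : 'M[R]_n) phi f : spectral_calculus A phi ->
  (forall a, eigenvalue A a -> 0 <= f a) -> psdmx (phi f).
Proof.
move=> calc f0.
pose r x := Num.sqrt (f x); have -> : phi f = (phi r)^T *m phi r.
  rewrite (calc_tr calc) -(calcM calc); apply: (eq_calc calc) => a /f0 fa.
  by rewrite -expr2 sqr_sqrtr.
exact: psd_gram.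
Qed.

(** The existence of the square root makes [psd_sqrt], which is defined by
    choice, satisfy its specification. *)
Lemma psd_sqrtP n (A : 'M[R]_n) : psdmx A ->
  psdmx (psd_sqrt A) /\ psd_sqrt A *m psd_sqrt A = A.
Proof.
move=> Apsd; apply: (@xgetPex _ 0 [set S | psdmx S /\ S *m S = A]%classic).
have [phi calc] := sym_calculus Apsd.1.
exists (phi Num.sqrt); split.
  by apply: (psd_calc calc) => a _; rewrite sqrtr_ge0.
rewrite -(calcM calc) -[RHS](calc_id calc); apply: (eq_calc calc) => a.
by move=> /(psd_eigenvalue Apsd); rewrite -expr2 => /sqr_sqrtr.
Qed.

(** If a vector y = A x of the range has Rayleigh quotient at most 1, then A has
    an eigenvalue in ]0, 1].  Otherwise each eigenvalue a is 0 or exceeds 1, and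
    g(a) = a sqrt(a - 1) satisfies a^3 - a^2 = g(a)^2.  The hypothesis on y says
    x^T (A^3 - A^2) x <= 0, so g(A) x = 0; on the spectrum g vanishes only
    at 0, so A x = 0. *)
Lemma small_eigenvalue n (A : 'M[R]_n) (x : 'cV[R]_n) : psdmx A ->
    A *m x != 0 ->
    ((A *m x)^T *m A *m (A *m x)) 0 0 <= normsq (A *m x) ->
  exists a, [/\ eigenvalue A a, 0 < a & a <= 1].
Proof.
move=> Apsd Ax0 le1; apply: contrapT => noev.
have [phi calc] := sym_calculus Apsd.1.
have gt1 a : eigenvalue A a -> a = 0 \/ 1 < a.
  move=> eva; have := psd_eigenvalue Apsd eva; rewrite le_eqVlt.
  case/predU1P => [->|a0]; [by left|right].
  by rewrite ltNge; apply/negP => a1; apply: noev; exists a.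
pose g a : R := a * Num.sqrt (a - 1); pose k a : R := (Num.sqrt (a - 1))^-1.
have A3 : A *m A *m A = A *m A + phi g *m phi g.
  rewrite -(calc_id calc) -!(calcM calc) -(calcD calc).
  apply: (eq_calc calc) => a /gt1; rewrite /g => -[->|a1].
    by rewrite !mul0r addr0.
  rewrite mulrACA -(expr2 (Num.sqrt _)) sqr_sqrtr ?subr_ge0 ?ltW//=.
  by rewrite mulrBr mulr1 addrC subrK.
(* At a = 0 both sides vanish, whatever the value of k. *)
have Akg : A = phi k *m phi g.
  rewrite -[LHS](calc_id calc) -(calcM calc); apply: (eq_calc calc) => a /gt1.
  rewrite /g /k => -[->|a1]; first by rewrite mul0r mulr0.
  by rewrite mulrCA mulVf ?mulr1// lt0r_neq0// sqrtr_gt0 subr_gt0.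
suff /eqP gx0 : phi g *m x == 0.
  by move/eqP: Ax0; apply; rewrite Akg -mulmxA gx0 mulmx0.
rewrite -normsq_eq0 eq_le normsq_ge0 andbT normsq_mul (calc_tr calc).
have -> : (x^T *m (phi g *m phi g) *m x) 0 0
        = ((A *m x)^T *m A *m (A *m x)) 0 0 - normsq (A *m x).
  rewrite normsq_mul trmx_mul Apsd.1.
  have -> : x^T *m A *m A *m (A *m x) = x^T *m (A *m A *m A) *m x.
    by rewrite !mulmxA.
  by rewrite A3 mulmxDr mulmxDl [X in _ = X - _]mxE addrAC subrr add0r.
by rewrite subr_le0.
Qed.

End PositiveSemidefinite.

(** * Moore-Penrose inverses *)

Section MoorePenrose.
Variable R : realType.

Lemma penrose_unique m n (A : 'M[R]_(m, n)) X Y :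
  penrose A X -> penrose A Y -> X = Y.
Proof.
move=> [AXA XAX AXt XAt] [AYA YAY AYt YAt].
have AXY : A *m X = A *m Y.
  by rewrite -[LHS]AXt -{1}AYA -(mulmxA (A *m Y)) trmx_mul AXt AYt mulmxA AXA.
have XYA : X *m A = Y *m A.
  rewrite -[LHS]XAt -{1}AYA -mulmxA mulmxA trmx_mul XAt YAt.
  by rewrite -mulmxA (mulmxA A) AXA.
by rewrite -XAX -mulmxA AXY mulmxA XYA YAY.
Qed.

Lemma mp_inv_eq m n (A : 'M[R]_(m, n)) X : penrose A X -> mp_inv A = X.
Proof. by move=> pX; apply: xget_unique => // Y /penrose_unique; apply. Qed.

Lemma penrose_tr m n (A : 'M[R]_(m, n)) X : penrose A X -> penrose A^T X^T.
Proof.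
move=> [AXA XAX AXt XAt]; split; rewrite -?trmx_mul ?mulmxA ?AXA ?XAX//.
  by rewrite XAt.
by rewrite AXt.
Qed.

(** The pseudoinverse of a symmetric matrix is the function a |-> a^-1 of it:
    the convention 0^-1 = 0 is exactly what the Penrose equations ask for. *)
Lemma mp_invP n (A : 'M[R]_n) : A^T = A -> penrose A (mp_inv A).
Proof.
move=> Asym; have [phi calc] := sym_calculus Asym.
suff pX : penrose A (phi GRing.inv) by rewrite (mp_inv_eq pX).
rewrite -(calc_id calc); split; rewrite -!(calcM calc) ?(calc_tr calc)//;
    apply: (eq_calc calc) => a _;
  by have [->|a0] := eqVneq a 0;
    rewrite ?(mul0r, mulr0)//= ?invr0 ?divff ?mulVf ?mul1r//.
Qed.

Lemma mp_inv_sym n (A : 'M[R]_n) : A^T = A -> (mp_inv A)^T = mp_inv A.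
Proof.
move=> Asym; apply/esym/mp_inv_eq.
by rewrite -{1}Asym; apply/penrose_tr/mp_invP.
Qed.

Lemma psd_mp_inv n (A : 'M[R]_n) : psdmx A -> psdmx (mp_inv A).
Proof.
move=> [Asym Apsd]; have Xsym := mp_inv_sym Asym; split=> // x.
have [_ <- _ _] := mp_invP Asym; have := Apsd (mp_inv A *m x).
by rewrite trmx_mul Xsym !mulmxA.
Qed.

End MoorePenrose.

(** * Orthogonal projectors *)

Section OrthogonalProjectors.
Variable R : realType.

Definition orthoproj n (P : 'M[R]_n) : Prop := P^T = P /\ P *m P = P.

Lemma orthoproj_psd n (P : 'M[R]_n) : orthoproj P -> psdmx P.
Proof. by move=> [Pt PP]; rewrite -PP -{1}Pt; apply: psd_gram. Qed.

Lemma orthoproj_quad n (P : 'M[R]_n) (x : 'cV_n) : orthoproj P ->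
  (x^T *m P *m x) 0 0 = normsq (P *m x).
Proof. by move=> [Pt PP]; rewrite normsq_mul Pt PP. Qed.

Lemma orthoproj_compl n (P : 'M[R]_n) : orthoproj P -> orthoproj (1%:M - P).
Proof.
move=> [Pt PP]; split; first by rewrite linearB /= trmx1 Pt.
by rewrite mulmxBr mulmx1 mulmxBl mul1mx PP subrr subr0.
Qed.

(** Pythagoras: |x|^2 = |P x|^2 + |(1 - P) x|^2. *)
Lemma orthoproj_le n (P : 'M[R]_n) (x : 'cV_n) : orthoproj P ->
  (x^T *m P *m x) 0 0 <= normsq x.
Proof.
move=> proj_P.
suff -> : normsq x = (x^T *m P *m x) 0 0 + normsq ((1%:M - P) *m x).
  by rewrite lerDl normsq_ge0.
rewrite -(orthoproj_quad _ (orthoproj_compl proj_P)) mulmxBr mulmx1 mulmxBl.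
by rewrite [X in _ + X]mxE [X in _ + (_ + X)]mxE addrC subrK.
Qed.

(** This identifies K^T (K K^T)^+ K as the orthogonal projector onto ran K^T: it
    fixes that range pointwise, and its own range is visibly inside. *)
Lemma row_space_proj m n (K : 'M[R]_(m, n)) :
  let P := K^T *m mp_inv (K *m K^T) *m K in orthoproj P /\ P *m K^T = K^T.
Proof.
set T := K *m K^T; set X := mp_inv T => P.
have Tsym : T^T = T by rewrite trmx_mul trmxK.
have [TXT XTX TXt XTt] := mp_invP Tsym.
have Xsym : X^T = X := mp_inv_sym Tsym.
split; [split|].
- by rewrite !trmx_mul trmxK Xsym mulmxA.
- rewrite /P -!mulmxA; congr (_ *m _); rewrite !mulmxA -(mulmxA X K) -/T.
  by rewrite XTX.
(* The Gram matrix of the transpose of this product is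
   (T X - 1) T (T X - 1)^T, and (T X - 1) T = 0. *)
have D0 : (T *m X - 1%:M) *m K = 0.
  apply/trmx_inj; rewrite linear0; apply: gram_eq0.
  rewrite trmxK trmx_mul -mulmxA (mulmxA K) -/T mulmxA mulmxBl mul1mx TXT subrr.
  by rewrite mul0mx.
have /(congr1 trmx) := D0; rewrite linear0 trmx_mul linearB /= TXt trmx1.
rewrite mulmxBr mulmx1 => /eqP; rewrite subr_eq0 => /eqP KTX.
by rewrite -[RHS]KTX -TXt trmx_mul Xsym Tsym !mulmxA.
Qed.

End OrthogonalProjectors.

(** * Singular values and the condition number *)

Section SingularValues.
Variable R : realType.

Lemma seq_extrema (t : seq R) (S : set R) x0 :
    (forall x, S x <-> x \in t) -> S x0 ->
  (exists2 y, S y & ubound S y) /\ (exists2 y, S y & lbound S y).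
Proof.
move=> St /St x0t; have i0 : 'I_(size t).
  by exists (index x0 t); rewrite index_mem.
pose f (i : 'I_(size t)) := t`_i.
have fS i : S (f i) by apply/St/mem_nth.
have Sf x : S x -> exists i, x = f i.
  move=> /St xt; have xi : (index x t < size t)%N by rewrite index_mem.
  by exists (Ordinal xi); rewrite /f nth_index.
split.
  exists (f [arg max_(i > i0) f i]%O) => // x /Sf[j ->].
  by case: arg_maxP => // i _; apply.
exists (f [arg min_(i < i0) f i]%O) => // x /Sf[j ->].
by case: arg_minP => // i _; apply.
Qed.

Lemma singular_value_seq m n (B : 'M[R]_(m, n)) :
  exists t : seq R, forall x, singular_value B x <-> x \in t.
Proof.
case: n B => [|n] B.
  exists [::] => x; split=> // -[_ /eigenvalueP[v _]].
  by rewrite [v]thinmx0 eqxx.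
have [s sE _] := @sym_spectrum R n (B^T *m B) (psd_gram B).1.
exists [seq Num.sqrt a | a <- s & 0 <= a] => x; split.
  move=> [x0]; rewrite sE => xs; apply/mapP; exists (x ^+ 2).
    by rewrite mem_filter sqr_ge0.
  by rewrite sqrtr_sqr ger0_norm.
move=> /mapP[a]; rewrite mem_filter => /andP[a0 sa] ->.
by split; rewrite ?sqrtr_ge0// sqr_sqrtr// sE.
Qed.

Lemma singular_valueE m n (B : 'M[R]_(m, n)) a : 0 <= a ->
  eigenvalue (B^T *m B) a -> singular_value B (Num.sqrt a).
Proof. by move=> a0 ev; split; rewrite ?sqrtr_ge0 ?sqr_sqrtr. Qed.

Lemma sigma_max_ge m n (B : 'M[R]_(m, n)) x :
  singular_value B x -> x <= sigma_max B.
Proof.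
move=> Bx; have [t tP] := singular_value_seq B.
have [[y By yub] _] := seq_extrema tP Bx.
have [_ ub] := @xgetPex _ 0
  (singular_value B `&` ubound (singular_value B))%classic
  (ex_intro _ y (conj By yub)).
exact: ub.
Qed.

Lemma sigma_min_pos_gt0_le m n (B : 'M[R]_(m, n)) x :
  singular_value B x -> x != 0 -> 0 < sigma_min_pos B <= x.
Proof.
move=> Bx x0; have [t tP] := singular_value_seq B.
pose S := [set s | singular_value B s /\ s != 0]%classic.
have SP y : S y <-> y \in [seq y <- t | y != 0].
  by rewrite mem_filter; split=> [[/tP -> ->]|/andP[y0 /tP]].
have [_ [y By ylb]] := seq_extrema SP (conj Bx x0).
have [[[ge0 _] neq0] lb] := @xgetPex _ 0 (S `&` lbound S)%classic
  (ex_intro _ y (conj By ylb)).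
by rewrite lt_def neq0 ge0 lb.
Qed.

(** Both extremal singular values exist because the set of singular values is
    finite and contains sqrt b > 0; they are at least sqrt a and at most sqrt b
    respectively. *)
Lemma cond_number_ge m n (B : 'M[R]_(m, n)) a b :
    eigenvalue (B^T *m B) a -> eigenvalue (B^T *m B) b -> 0 <= a -> 0 < b ->
  Num.sqrt (a / b) <= cond_number B.
Proof.
move=> eva evb a0 b0; have b1 : 0 < Num.sqrt b by rewrite sqrtr_gt0.
have max_a := sigma_max_ge (singular_valueE a0 eva).
have /andP[min0 min_b] :=
  sigma_min_pos_gt0_le (singular_valueE (ltW b0) evb) (lt0r_neq0 b1).
rewrite sqrtrM// (sqrtrV (ltW b0)) /cond_number.
by apply: ler_pM; rewrite ?invr_ge0 ?sqrtr_ge0// lef_pV2.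
Qed.

Lemma col_eigenvalue n (A : 'M[R]_n) (v : 'cV_n) a :
  A^T = A -> v != 0 -> A *m v = a *: v -> eigenvalue A a.
Proof.
move=> Asym v0 Av; apply/eigenvalueP; exists v^T; last by rewrite trmx_eq0.
by rewrite -[in LHS]Asym -trmx_mul Av linearZ.
Qed.

(** The analytic core: v witnesses the eigenvalue 2 of P + Q, and w an eigenvalue
    in ]0, 1].  For the latter w must be in the range of M = P + Q: the
    projector N = 1 - M^+ M onto ker M is killed by P and by Q, because their
    quadratic forms are nonnegative and add up to that of M; hence N w = 0. *)
Lemma cond_number_sum_proj m n (B : 'M[R]_(m, n)) (P Q : 'M_n)
    (v w a b : 'cV_n) :
    orthoproj P -> orthoproj Q -> B^T *m B = P + Q ->
    v != 0 -> P *m v = v -> Q *m v = v ->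
    w != 0 -> P *m w = 0 -> w = P *m a + Q *m b ->
  Num.sqrt 2 <= cond_number B.
Proof.
move=> pP pQ BB v0 Pv Qv w0 Pw wE.
have Mpsd : psdmx (P + Q) by apply: psdmxD; apply: orthoproj_psd.
have [Msym M0] := Mpsd.
have ev2 : eigenvalue (B^T *m B) 2.
  rewrite BB; apply: (col_eigenvalue Msym v0).
  by rewrite mulmxDl Pv Qv scaler_nat.
have [MXM _ MXt XMt] := mp_invP Msym.
set X := mp_inv (P + Q) in MXM MXt XMt.
pose N := 1%:M - X *m (P + Q).
have MN : (P + Q) *m N = 0 by rewrite mulmxBr mulmx1 mulmxA MXM subrr.
have Nt : N^T = N by rewrite linearB /= trmx1 XMt.
(* The Gram matrix of P N stacked on Q N is N M N = 0. *)
pose PQN := col_mx (P *m N) (Q *m N).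
have /gram_eq0/eqP : PQN^T *m PQN = 0.
  rewrite tr_col_mx mul_row_col !trmx_mul pP.1 pQ.1 !mulmxA.
  rewrite -!(mulmxA _ P P) -!(mulmxA _ Q Q) pP.2 pQ.2 -mulmxDl -mulmxDr.
  by rewrite -mulmxA MN mulmx0.
rewrite col_mx_eq0 => /andP[/eqP/(congr1 trmx) + /eqP/(congr1 trmx)].
rewrite !trmx_mul pP.1 pQ.1 Nt !linear0 => NP NQ.
have Nw : N *m w = 0 by rewrite wE mulmxDr !mulmxA NP NQ !mul0mx addr0.
have wM : (P + Q) *m (X *m w) = w.
  apply/esym/eqP; rewrite -subr_eq0 -Nw mulmxBl mul1mx mulmxA -MXt trmx_mul.
  by rewrite Msym mp_inv_sym.
have [] := @small_eigenvalue R n (P + Q) (X *m w) Mpsd.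
- by rewrite wM.
- rewrite wM mulmxDr mulmxDl -[_ *m P *m w]mulmxA Pw mulmx0 add0r.
  exact: orthoproj_le.
move=> c [evc c0 c1]; rewrite -BB in evc.
apply: le_trans (cond_number_ge ev2 evc _ c0); last by [].
by rewrite ler_wsqrtr// ler_pdivlMr// ler_piMr.
Qed.

End SingularValues.

(** * Block diagonal preconditioning *)

Section Blocks.
Variables (R : realType) (m m1 m2 : nat).
Variables (P1 : 'M[R]_(m1, m)) (P2 : 'M[R]_(m2, m)).
Hypotheses (P11 : P1 *m P1^T = 1%:M) (P22 : P2 *m P2^T = 1%:M)
  (P12 : P1 *m P2^T = 0) (Pcover : P1^T *m P1 + P2^T *m P2 = 1%:M).

Definition blockdiag (A1 : 'M[R]_m1) (A2 : 'M[R]_m2) : 'M[R]_m :=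
  P1^T *m A1 *m P1 + P2^T *m A2 *m P2.

Lemma blockdiagM A1 A2 B1 B2 :
  blockdiag A1 A2 *m blockdiag B1 B2 = blockdiag (A1 *m B1) (A2 *m B2).
Proof.
have P21 : P2 *m P1^T = 0 by rewrite -[LHS]trmxK trmx_mul trmxK P12 linear0.
rewrite /blockdiag mulmxDl !mulmxDr !mulmxA.
rewrite -!(mulmxA _ P1 P1^T) -!(mulmxA _ P2 P2^T) -!(mulmxA _ P1 P2^T).
rewrite -!(mulmxA _ P2 P1^T) P11 P22 P12 P21.
by rewrite !(mulmx0, mul0mx, mulmx1, addr0, add0r).
Qed.

Lemma tr_blockdiag A1 A2 : (blockdiag A1 A2)^T = blockdiag A1^T A2^T.
Proof. by rewrite linearD /= !trmx_mul !trmxK !mulmxA. Qed.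

Lemma mp_inv_blockdiag A1 A2 : A1^T = A1 -> A2^T = A2 ->
  mp_inv (blockdiag A1 A2) = blockdiag (mp_inv A1) (mp_inv A2).
Proof.
move=> /mp_invP[AXA1 XAX1 AXt1 XAt1] /mp_invP[AXA2 XAX2 AXt2 XAt2].
apply: mp_inv_eq; split; rewrite ?blockdiagM ?tr_blockdiag.
- by rewrite AXA1 AXA2.
- by rewrite XAX1 XAX2.
- by rewrite AXt1 AXt2.
- by rewrite XAt1 XAt2.
Qed.

Lemma psd_blockdiag A1 A2 : psdmx A1 -> psdmx A2 -> psdmx (blockdiag A1 A2).
Proof.
move=> [At1 A10] [At2 A20]; split=> [|x]; first by rewrite tr_blockdiag At1 At2.
rewrite mulmxDr mulmxDl mxE addr_ge0//.
  by have := A10 (P1 *m x); rewrite trmx_mul !mulmxA.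
by have := A20 (P2 *m x); rewrite trmx_mul !mulmxA.
Qed.

(** The theorem for an arbitrary matrix K whose rows are split into two blocks;
    the graph enters only through the rank and range conditions. *)
Lemma cond_number_precond n (K : 'M[R]_(m, n)) (v : 'cV_n) :
  let K1 := P1 *m K in let K2 := P2 *m K in
  v != 0 -> (exists x, v = K1^T *m x) -> (exists x, v = K2^T *m x) ->
  (minn (\rank K1) (\rank K2) < \rank K)%N ->
  Num.sqrt 2 <=
    cond_number (psd_sqrt (mp_inv (blockdiag (K1 *m K1^T) (K2 *m K2^T))) *m K).
Proof.
move=> K1 K2 v0 [x1 vx1] [x2 vx2].
have [proj1 fix1] := row_space_proj K1; have [proj2 fix2] := row_space_proj K2.
set Q1 := (X in orthoproj X) in proj1 fix1.
set Q2 := (X in orthoproj X) in proj2 fix2.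
have psdKK k (L : 'M[R]_(k, n)) : psdmx (L *m L^T).
  by rewrite -{1}[L]trmxK; apply: psd_gram.
set T := blockdiag _ _; set S := psd_sqrt _.
have Tpsd : psdmx T by apply: psd_blockdiag.
have [Spsd SS] := psd_sqrtP (psd_mp_inv Tpsd); rewrite -/S in Spsd SS.
have gram : (S *m K)^T *m (S *m K) = Q1 + Q2.
  rewrite trmx_mul mulmxA -(mulmxA _ S^T) Spsd.1 SS.
  rewrite mp_inv_blockdiag ?(psdKK _ _).1//.
  by rewrite mulmxDr mulmxDl /Q1 /Q2 !trmx_mul !mulmxA.
have v1 : Q1 *m v = v by rewrite vx1 mulmxA fix1.
have v2 : Q2 *m v = v by rewrite vx2 mulmxA fix2.
have KE : K^T = K1^T *m P1 + K2^T *m P2.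
  by rewrite !trmx_mul -!mulmxA -mulmxDr Pcover mulmx1.
have ran_w (c : 'cV_m) : K^T *m c =
    Q1 *m (K^T *m (P1^T *m P1 *m c)) + Q2 *m (K^T *m (P2^T *m P2 *m c)).
  by rewrite !mulmxA -!(mulmxA _ K^T) -!trmx_mul fix1 fix2 -mulmxDl KE.
(* Otherwise ker (K L^T) = ker K (acting on rows), and the ranks of
   K and K L^T agree, although the latter is at most the rank of L. *)
have outside k (L : 'M[R]_(k, n)) : (\rank L < \rank K)%N ->
    exists c : 'cV_m, K^T *m c != 0 /\ L *m (K^T *m c) = 0.
  move=> rk; apply: contrapT => none; move: rk; rewrite ltnNge => /negP; apply.
  suff : (kermx (K *m L^T) <= kermx K)%MS.
    move/mxrankS; rewrite !mxrank_ker leq_sub2lE ?rank_leq_row// => /leq_trans.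
    by apply; rewrite -(mxrank_tr L) mxrankM_maxr.
  apply/row_subP => i; apply/sub_kermxP; set r := row i _.
  have rKL : r *m (K *m L^T) = 0 by apply/sub_kermxP/row_sub.
  apply: contrapT => rK; apply: none; exists r^T; split.
    by rewrite -trmx_mul trmx_eq0; apply/eqP.
  by rewrite -trmx_mul -[L]trmxK -trmx_mul -mulmxA rKL linear0.
rewrite gtn_min => /orP[] /outside[c [w0 Lw]].
- apply: (cond_number_sum_proj proj1 proj2 gram v0 v1 v2 w0 _ (ran_w c)).
  by rewrite -mulmxA Lw mulmx0.
- rewrite addrC in gram.
  have := ran_w c; rewrite addrC => ran_w'.
  apply: (cond_number_sum_proj proj2 proj1 gram v0 v2 v1 w0 _ ran_w').
  by rewrite -mulmxA Lw mulmx0.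
Qed.

End Blocks.

(** * Restriction to a set of edges *)

Section Restriction.
Variables (R : realType) (V : finType).
Implicit Types E F : {set {set V}}.

Lemma restr_mulmx_tr E F F' i j : F \subset E ->
  (restr_mx R E F *m (restr_mx R E F')^T) i j = (enum_val i == enum_val j)%:R.
Proof.
move=> FE; have iE : enum_val i \in E := fintype.subsetP FE _ (enum_valP i).
rewrite mxE.
under eq_bigr do rewrite !mxE -natrM mulnb.
rewrite -(@big_enum_val _ _ _ _ (mem E) (fun e =>
  ((enum_val i == e) && (enum_val j == e))%:R)) /=.
rewrite (bigD1 (enum_val i)) //= eqxx [enum_val j == _]eq_sym /=.
rewrite big1 ?addr0// => e /andP[_ ne].
by rewrite [enum_val i == _]eq_sym (negPf ne).
Qed.

Lemma restr_mxK E F : F \subset E ->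
  restr_mx R E F *m (restr_mx R E F)^T = 1%:M.
Proof.
move=> FE; apply/matrixP => i j.
by rewrite restr_mulmx_tr// mxE (inj_eq enum_val_inj).
Qed.

Lemma restr_mx_disjoint E F F' : F \subset E -> [disjoint F & F'] ->
  restr_mx R E F *m (restr_mx R E F')^T = 0.
Proof.
move=> FE dis; apply/matrixP => i j; rewrite restr_mulmx_tr// mxE.
case: eqP => // ij; have := disjointFr dis (enum_valP i).
by rewrite ij enum_valP.
Qed.

Lemma restr_tr_mulmx E F i j :
  ((restr_mx R E F)^T *m restr_mx R E F) i j =
  ((enum_val i \in F) && (i == j))%:R.
Proof.
rewrite mxE.
under eq_bigr do rewrite !mxE -natrM mulnb.
rewrite -(@big_enum_val _ _ _ _ (mem F) (fun e =>
  ((e == enum_val i) && (e == enum_val j))%:R)) /=.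
have [iF|iF] := boolP (enum_val i \in F); last first.
  rewrite big1// => e eF; case: eqP => // ei; by rewrite -ei eF in iF.
rewrite (bigD1 (enum_val i))//= eqxx (inj_eq enum_val_inj).
by rewrite big1 ?addr0// => e /andP[_ /negPf ->].
Qed.

Lemma restr_mx_cover E F F' : F :|: F' = E -> [disjoint F & F'] ->
  (restr_mx R E F)^T *m restr_mx R E F +
  (restr_mx R E F')^T *m restr_mx R E F' = 1%:M.
Proof.
move=> FFE dis; apply/matrixP => i j; rewrite mxE !restr_tr_mulmx mxE.
have : enum_val i \in F :|: F' by rewrite FFE enum_valP.
rewrite finset.in_setU => /orP[iF|iF].
  by rewrite iF (disjointFr dis iF) addr0.
by rewrite iF (disjointFl dis iF) add0r.
Qed.

Lemma restr_diag E F (w : {set V} -> R) :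
  restr_mx R E F *m diag_mx (\row_i w (enum_val i)) =
  diag_mx (\row_i w (enum_val i)) *m restr_mx R E F.
Proof.
apply/matrixP => i j; rewrite mul_mx_diag mul_diag_mx !mxE.
by case: eqP => [->|_]; rewrite ?mulr1 ?mul1r// mulr0 mul0r.
Qed.

End Restriction.

(** * The condition number of the preconditioned incidence matrix *)

Theorem theorem1 (R : realType) (V : finType) (G : wgraph R V)
    (o : orientation (edges G)) (E1 E2 : {set {set V}})
    (E1_neq0 : E1 != finset.set0) (E2_neq0 : E2 != finset.set0)
    (E12_disj : [disjoint E1 & E2]) (E12_cover : E1 :|: E2 = edges G) :
  let nabla := grad R o in
  let K := weight_mx G *m nabla in
  let P1 := restr_mx R (edges G) E1 in
  let P2 := restr_mx R (edges G) E2 in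
  let nabla1 := P1 *m nabla in
  let nabla2 := P2 *m nabla in
  let K1 := P1 *m K in
  let K2 := P2 *m K in
  let T := P1^T *m (K1 *m K1^T) *m P1 + P2^T *m (K2 *m K2^T) *m P2 in
  ([set 0] `<` ran nabla1^T `&` ran nabla2^T)%classic ->
  (minn (\rank nabla1^T) (\rank nabla2^T) < \rank nabla^T)%N ->
  Num.sqrt 2 <= cond_number (psd_sqrt (mp_inv T) *m K).
Proof.
move=> nabla K P1 P2 nabla1 nabla2 K1 K2 T [_ ranN] rkN.
have sE1 : E1 \subset edges G by rewrite -E12_cover finset.subsetUl.
have sE2 : E2 \subset edges G by rewrite -E12_cover finset.subsetUr.
pose W (F : {set {set V}}) : 'M[R]_#|F| :=
  diag_mx (\row_i weight G (enum_val i)).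
have Wunit (F : {set {set V}}) : F \subset edges G -> W F \in unitmx.
  move=> FG; rewrite unitmxE det_diag unitfE; apply/prodf_neq0 => i _.
  by rewrite mxE lt0r_neq0// weight_gt0 ?(fintype.subsetP FG) ?enum_valP.
(* Each K_l is nabla_l with rows rescaled by the positive weights, so ranks and
   ranges of transposes agree. *)
have K1E : K1 = W E1 *m nabla1 by rewrite /K1 mulmxA restr_diag mulmxA.
have K2E : K2 = W E2 *m nabla2 by rewrite /K2 mulmxA restr_diag mulmxA.
have rankW (F : {set {set V}}) (N : 'M[R]_(#|F|, #|V|)) : F \subset edges G ->
    \rank (W F *m N) = \rank N^T.
  by move=> /Wunit WF; rewrite mxrank_tr eqmxMfull// row_full_unit.
have ranW (F : {set {set V}}) (N : 'M[R]_(#|F|, #|V|)) v : F \subset edges G ->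
    ran N^T v -> exists x, v = (W F *m N)^T *m x.
  move=> /Wunit WF [x _ <-]; exists (invmx (W F)^T *m x).
  by rewrite trmx_mul -mulmxA mulKVmx// unitmx_tr.
have [v [[v1 v2] v0]] :
    exists v, (ran nabla1^T `&` ran nabla2^T)%classic v /\ v != 0.
  apply: contrapT => none; apply: ranN => v vran; apply: contrapT => v0.
  by apply: none; exists v; split=> //; apply/eqP.
apply: (@cond_number_precond R _ _ _ P1 P2 _ _ _ _ _ K v).
- exact: restr_mxK.
- exact: restr_mxK.
- exact: restr_mx_disjoint.
- exact: restr_mx_cover.
- exact: v0.
- by rewrite -/K1 K1E; apply: ranW.
- by rewrite -/K2 K2E; apply: ranW.
- by rewrite -/K1 -/K2 K1E K2E !rankW.
Qed.
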